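(* Let $G$ be a Garside group with Garside element $\Delta$, let $\Delta^m$ be the minimal positive central power of $\Delta$, and let $G_\Delta=G/\langle\Delta^m\rangle$. Then every finite subgroup of $G_\Delta$ is cyclic.
   Context: Garside groups. In a monoid $M$, an atom is an element $a\neq 1$ such that $a=bc$ implies $b=1$ or $c=1$; $\Vert a\Vert$ is the supremum of the lengths of expressions of $a$ as products of atoms. $M$ is atomic if it is generated by its atoms and $\Vert a\Vert<\infty$ for all $a\in M$. Put $a\le_L b$ if $ac=b$ for some $c\in M$, and $a\le_R b$ if $ca=b$ for some $c\in M$. A Garside monoid is an atomic, left and right cancellative monoid $M$ such that $(M,\le_L)$ and $(M,\le_R)$ are lattices and $M$ contains a Garside element $\Delta$, i.e. an element such that for each $a\in M$, $a\le_L\Delta$ iff $a\le_R\Delta$, and the set $[1,\Delta]=\{a\in M: 1\le_L a\le_L\Delta\}$ is finite and generates $M$. A Garside group $G$ with Garside element $\Delta$ is the group of fractions of a Garside monoid $M$ with Garside element $\Delta$; $M$ is identified with its image in $G$. Some positive power of $\Delta$ is always central; $m$ is the smallest positive integer such that $\Delta^m$ is central in $G$, and $\langle\Delta^m\rangle$ is the cyclic subgroup it generates. *)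

(* Defs.v *)
From HB Require Import structures.
From mathcomp Require Import all_boot all_order.
From mathcomp Require Import boolp classical_sets functions cardinality.

Set Implicit Arguments.
Unset Strict Implicit.
Unset Printing Implicit Defensive.

Local Open Scope classical_set_scope.
Local Open Scope group_scope.

Section Order.
Variables (T : Type) (le : T -> T -> Prop).

Definition is_porder : Prop :=
  [/\ forall x, le x x,
      forall x y, le x y -> le y x -> x = y
    & forall x y z, le x y -> le y z -> le x z].

Definition is_meet (x y z : T) : Prop :=
  [/\ le z x, le z y & forall t, le t x -> le t y -> le t z].

Definition is_join (x y z : T) : Prop :=
  [/\ le x z, le y z & forall t, le x t -> le y t -> le z t].

Definition is_lattice : Prop :=
  [/\ is_porder, forall x y, exists z, is_meet x y z
    & forall x y, exists z, is_join x y z].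

End Order.

Section GarsideMonoid.
Variable M : monoidType.

Definition atom (a : M) : Prop :=
  a <> 1 /\ forall b c : M, a = b * c -> b = 1 \/ c = 1.

Definition is_word (S : set M) (s : seq M) (a : M) : Prop :=
  {in s, forall x, S x} /\ \prod_(x <- s) x = a.

Definition generates (S : set M) : Prop := forall a, exists s, is_word S s a.

Definition atom_lengths (a : M) : set nat :=
  [set n | exists2 s, is_word [set x | atom x] s a & size s = n].

(* ||a|| is the supremum of [atom_lengths a]; it is finite iff this set is
   bounded above. *)
Definition norm_finite (a : M) : Prop :=
  exists n, forall k, atom_lengths a k -> (k <= n)%N.

Definition atomic : Prop :=
  generates [set x | atom x] /\ forall a, norm_finite a.

Definition leL (a b : M) : Prop := exists c, a * c = b.
Definition leR (a b : M) : Prop := exists c, c * a = b.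

Definition divisors (Delta : M) : set M := [set a | leL 1 a /\ leL a Delta].

Definition garside_element (Delta : M) : Prop :=
  [/\ forall a, leL a Delta <-> leR a Delta,
      finite_set (divisors Delta)
    & generates (divisors Delta)].

(* [right_injective] (resp. [left_injective]) of the product is left (resp.
   right) cancellativity. *)
Definition garside_monoid (Delta : M) : Prop :=
  [/\ atomic,
      right_injective (@mul M) /\ left_injective (@mul M),
      is_lattice leL, is_lattice leR & garside_element Delta].

End GarsideMonoid.

(* As any two elements of a Garside monoid have common multiples on both sides,
   left and right fractions describe the same group. *)
Definition group_of_fractions (M : monoidType) (G : groupType) (iota : M -> G)
    : Prop :=
  [/\ monoid_morphism iota, injective iota
    & forall g : G, exists a b : M, g = iota a / iota b].

Definition garside_group (G : groupType) (Delta : G) : Prop :=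
  exists (M : monoidType) (iota : M -> G) (D : M),
    [/\ garside_monoid D, group_of_fractions iota & iota D = Delta].

Section Subgroups.
Variable G : groupType.

Definition subgroup (H : set G) : Prop :=
  [/\ H 1, forall x y, H x -> H y -> H (x * y) & forall x, H x -> H x^-1].

Definition cyclic_subgroup (g : G) : set G :=
  [set x | exists n : nat, x = g ^+ n \/ x = g ^- n].

Definition cyclic (H : set G) : Prop := exists g, H = cyclic_subgroup g.

Definition central (z : G) : Prop := forall x : G, commute z x.

Definition least_central_power (z : G) (m : nat) : Prop :=
  [/\ (0 < m)%N, central (z ^+ m)
    & forall k : nat, (0 < k)%N -> central (z ^+ k) -> (m <= k)%N].

Record normal_subgroup := NormalSubgroup {
  normal_set : set G;
  normalP : subgroup normal_set;
  normalJ : forall x g : G, normal_set x -> normal_set (x ^ g) }.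

Lemma cyclic_subgroupP (g : G) : subgroup (cyclic_subgroup g).
Proof.
have cV x : cyclic_subgroup g x -> cyclic_subgroup g x^-1.
  by case=> n [] ->; exists n; [right | left; rewrite invgK].
have cA n p : cyclic_subgroup g (g ^+ n * g ^- p).
  case: (leqP p n) => [le_pn | /ltnW le_np].
    by exists (n - p)%N; left; rewrite -{1}(subnK le_pn) expgnDr mulgK.
  exists (p - n)%N; right.
  by rewrite -{1}(subnK le_np) expgnDr invgM mulVKg.
have cB n p : cyclic_subgroup g (g ^- n * g ^+ p).
  case: (leqP n p) => [le_np | /ltnW le_pn].
    by exists (p - n)%N; left; rewrite -{1}(subnKC le_np) expgnDr mulKg.
  exists (n - p)%N; right.
  by rewrite -{1}(subnKC le_pn) expgnDr invgM mulgVK.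
split=> //; first by exists 0%N; left.
move=> _ _ [n [] ->] [p [] ->] //.
- by exists (n + p)%N; left; rewrite expgnDr.
- by exists (p + n)%N; right; rewrite expgnDr invgM.
Qed.

Lemma cyclic_subgroupJ (z : G) : central z ->
  forall x g : G, cyclic_subgroup z x -> cyclic_subgroup z (x ^ g).
Proof.
move=> cz x g zx; have cx : commute x g.
  case: zx => n [] ->; apply: commute_sym; last apply: commuteV.
    by apply: commuteX; apply: commute_sym; apply: cz.
  by apply: commuteX; apply: commute_sym; apply: cz.
by rewrite /conjg cx mulKg.
Qed.

Definition central_cycle (z : G) (cz : central z) : normal_subgroup :=
  NormalSubgroup (cyclic_subgroupP z) (cyclic_subgroupJ cz).

Lemma least_central_power_central (z : G) (m : nat) :
  least_central_power z m -> central (z ^+ m).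
Proof. by case. Qed.

End Subgroups.

Section Quotient.
Variables (G : groupType) (N : normal_subgroup G).

Definition coset_rel (x y : G) : bool := `[< normal_set N (x^-1 * y) >].

Lemma coset_rel_equiv : equiv_class_of coset_rel.
Proof.
have [N1 NM NV] := normalP N.
split=> [x | x y | y x z].
- by apply/asboolP; rewrite mulVg.
- by apply/asboolP/asboolP => /NV; rewrite invgM invgK.
- by move=> /asboolP xy /asboolP yz; apply/asboolP;
    have := NM _ _ xy yz; rewrite mulgA mulgK.
Qed.

Canonical coset_equiv := EquivRelPack coset_rel_equiv.

Definition quotient_group : Type := {eq_quot coset_equiv}%qT.

HB.instance Definition _ := Choice.on quotient_group.

Definition coset (x : G) : quotient_group :=
  (\pi_({eq_quot coset_equiv}) x)%qT.

Definition coset_repr (u : quotient_group) : G :=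
  repr (u : {eq_quot coset_equiv}%qT).

Lemma coset_reprK : cancel coset_repr coset.
Proof. exact: reprK. Qed.

Lemma eq_coset (x y : G) : coset x = coset y <-> normal_set N (x^-1 * y).
Proof. by split=> [/eqmodP/asboolP | ?]; last by apply/eqmodP/asboolP. Qed.

Definition quotient_mul (u v : quotient_group) : quotient_group :=
  coset (coset_repr u * coset_repr v).

Definition quotient_inv (u : quotient_group) : quotient_group :=
  coset (coset_repr u)^-1.

Lemma coset_mul (x y : G) : quotient_mul (coset x) (coset y) = coset (x * y).
Proof.
have [_ NM _] := normalP N.
have /eq_coset Nx := coset_reprK (coset x).
have /eq_coset Ny := coset_reprK (coset y).
apply/eq_coset; have := NM _ _ (normalJ (coset_repr (coset y)) Nx) Ny.
by rewrite /conjg invgM !mulgA mulgK.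
Qed.

Lemma coset_inv (x : G) : quotient_inv (coset x) = coset x^-1.
Proof.
have [_ _ NV] := normalP N.
have /eq_coset Nx := coset_reprK (coset x).
apply/eq_coset; have := normalJ x^-1 (NV _ Nx).
by rewrite /conjg !invgM !invgK !mulgA mulgV mul1g.
Qed.

Fact quotient_mulA : associative quotient_mul.
Proof.
move=> u v w; rewrite -[u]coset_reprK -[v]coset_reprK -[w]coset_reprK.
by rewrite !coset_mul mulgA.
Qed.

Fact quotient_mul1 : left_id (coset 1) quotient_mul.
Proof. by move=> u; rewrite -[u]coset_reprK coset_mul mul1g. Qed.

Fact quotient_mulr1 : right_id (coset 1) quotient_mul.
Proof. by move=> u; rewrite -[u]coset_reprK coset_mul mulg1. Qed.

Fact quotient_mulV : left_inverse (coset 1) quotient_inv quotient_mul.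
Proof. by move=> u; rewrite -[u]coset_reprK coset_inv coset_mul mulVg. Qed.

Fact quotient_mulrV : right_inverse (coset 1) quotient_inv quotient_mul.
Proof. by move=> u; rewrite -[u]coset_reprK coset_inv coset_mul mulgV. Qed.

HB.instance Definition _ := isGroup.Build quotient_group
  quotient_mulA quotient_mul1 quotient_mulr1 quotient_mulV quotient_mulrV.

Lemma cosetM (x y : G) : coset (x * y) = coset x * coset y.
Proof. by rewrite -coset_mul. Qed.

End Quotient.

(* Main.v *)
(** A Garside group is torsion-free: it is a lattice for the right-invariant
    order [a <= b] iff [b a^-1] is in the monoid, and if [g ^+ n = 1] then right
    multiplication by [g] permutes [1, g, ..., g^(n-1)], hence fixes their join,
    so [g = 1].

    Let [z = Delta^m]. The preimage [K] in [G] of a finite subgroup [H] of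
    [G / <z>] contains the central infinite cyclic group [<z>] with finite
    index, and the transfer [K -> <z>] maps [z] to [z ^+ #|H|]. Its kernel meets
    [<z>] trivially, so consists of torsion elements and is trivial. Hence [K]
    embeds in the integers and is cyclic, and so is its quotient [H]. *)
Require Import Defs.
From mathcomp Require Import all_boot all_order.
From mathcomp Require Import boolp classical_sets functions cardinality.
From mathcomp Require Import ssralg ssrnum ssrint intdiv.

Set Implicit Arguments.
Unset Strict Implicit.
Unset Printing Implicit Defensive.

Import Order.TTheory GRing.Theory Num.Theory.
Local Open Scope classical_set_scope.
Local Open Scope group_scope.

(** * Torsion-freeness from a right-invariant order with joins *)

Definition torsion_free (G : groupType) : Prop :=
  forall (g : G) n, (0 < n)%N -> g ^+ n = 1 -> g = 1.

Section RightInvariantOrder.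
Variables (G : groupType) (le : G -> G -> Prop).
Hypothesis le_porder : is_porder le.
Hypothesis le_mulr : forall x y z, le x y -> le (x * z) (y * z).
Hypothesis le_join : forall x y, exists z, is_join le x y z.

(** Iterated binary joins; [J] is recorded through its upper bounds so that it can be compared with
    [J * g]. *)
Lemma powers_join (g : G) n : exists J, forall t,
  le J t <-> forall i, (i <= n)%N -> le (g ^+ i) t.
Proof.
have [_ _ le_trans] := le_porder.
elim: n => [|n [J IH]].
  by exists 1 => t; split=> [le1t [] | /(_ 0%N)] //; apply.
have [z [Jz gz zP]] := le_join J (g ^+ n.+1).
exists z => t; split=> [zt i | lt].
  rewrite leq_eqVlt ltnS => /orP [/eqP -> | le_in]; first exact: le_trans zt.
  by move: i le_in; apply/IH; apply: le_trans zt.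
by apply: zP; [apply/IH => i le_in | ]; apply: lt => //; apply: leqW.
Qed.

Lemma right_order_torsion_free : torsion_free G.
Proof.
have [le_refl le_anti _] := le_porder.
move=> g [//|n] _ gn1; have [J JP] := powers_join g n.
have le_mulrV x y : le (x * g) y <-> le x (y / g).
  split=> /le_mulr; first by move=> /(_ g^-1); rewrite mulgK.
  by move=> /(_ g); rewrite mulgVK.
(* Right multiplication by [g] shifts the exponents [0..n] by one, and [g ^+ n.+1 = 1] closes the
   cycle. *)
have JgP t : le (J * g) t <-> le J t.
  rewrite le_mulrV; split=> /JP le_t; apply/JP => [] i le_in.
    case: i le_in => [_ | i /ltnW le_in].
      by rewrite expg0 -gn1 expgSr le_mulrV; apply: le_t.
    by rewrite expgSr le_mulrV; apply: le_t.
  rewrite -le_mulrV -expgSr; move: le_in; rewrite leq_eqVlt.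
  by case/orP=> [/eqP -> | ]; [rewrite gn1 -[1](expg0 g) | ]; apply: le_t.
apply: (@mulgI _ J); rewrite mulg1.
by apply: le_anti; [apply/JgP | apply/JgP]; apply: le_refl.
Qed.

End RightInvariantOrder.

(** A join of the denominators in [leL] gives a common denominator; the join of the new numerators
    in [leR], over it, is the join in [G]. *)
Lemma garside_torsion_free (G : groupType) (Delta : G) :
  garside_group Delta -> torsion_free G.
Proof.
case=> M [iota [D [[_ _ [_ _ joinL] [[_ antiR _] _ joinR] _]]]].
move=> [[iota1 iotaM] iota_inj iotaF] _.
pose le (a b : G) := exists p, iota p * a = b.
have le_mulr x y z : le x y -> le (x * z) (y * z).
  by case=> p <-; exists p; rewrite mulgA.
have le_porder : is_porder le.
  split=> [x | x y [p px] [q qy] | x y z [p <-] [q <-]].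
  - by exists 1; rewrite iota1 mul1g.
  - have qp1 : q * p = 1.
      apply: iota_inj; rewrite iotaM iota1; apply: (@mulIg _ x).
      by rewrite -mulgA px qy mul1g.
    (* Antisymmetry of [leR] leaves 1 as the only invertible element of [M]. *)
    have p1 : p = 1 by apply: antiR; [exists q | exists p; rewrite mulg1].
    by rewrite -px p1 iota1 mul1g.
  - by exists (q * p); rewrite iotaM mulgA.
apply: right_order_torsion_free le_porder le_mulr _ => x y.
have [[a1 [b1 ->]] [a2 [b2 ->]]] := (iotaF x, iotaF y).
have [_ [[c1 <-] [c2 c12] _]] := joinL b1 b2.
have [u [[p pu] [q qu] uP]] := joinR (a1 * c1) (a2 * c2).
have denom a b c : iota a / iota b = iota (a * c) / iota (b * c).
  by rewrite !iotaM mulgKA.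
exists (iota u / iota (b1 * c1)); split.
- by exists p; rewrite (denom _ _ c1) mulgA -iotaM pu.
- by exists q; rewrite (denom _ _ c2) c12 mulgA -iotaM qu.
move=> t [r rt] [s st]; set v := r * (a1 * c1).
(* Both products are [t] cleared of the common denominator, so [v] is a common left multiple of the
   numerators. *)
have sv : s * (a2 * c2) = v.
  apply: iota_inj; apply: (@mulIg _ (iota (b1 * c1))^-1); rewrite /v.
  by rewrite !(iotaM r) !(iotaM s) -!mulgA -denom -c12 -denom rt st.
have [w wv] := uP v (ex_intro _ r erefl) (ex_intro _ s sv).
by exists w; rewrite mulgA -iotaM wv iotaM -mulgA -denom.
Qed.

(** * Integer powers and subgroups embedded in the integers *)

Section IntegerPowers.
Variable G : groupType.
Implicit Types (x : G) (k l : int).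

Definition additive_on (K : set G) (f : G -> int) : Prop :=
  forall x y, K x -> K y -> f (x * y) = (f x + f y)%R.

Definition expgz x k : G :=
  match k with Posz n => x ^+ n | Negz n => x ^- n.+1 end.

Lemma expgz_succ x k : expgz x (k + 1) = expgz x k * x.
Proof.
case: k => [n | [|n]]; first by rewrite -PoszD addn1 /= expgSr.
  by rewrite /= mulVg.
have -> : (Negz n.+1 + 1 = Negz n)%R.
  by rewrite !NegzE -addn1 PoszD opprD addrNK.
by rewrite /= [x ^+ n.+2]expgS invgM mulgVK.
Qed.

Lemma expgzD x k l : expgz x (k + l) = expgz x k * expgz x l.
Proof.
elim: l => [|n IH|n IH]; first by rewrite addr0 mulg1.
  by rewrite -addn1 PoszD addrA !expgz_succ IH mulgA.
apply: (@mulIg _ x); rewrite -mulgA -!expgz_succ -addrA.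
by rewrite -addn1 PoszD opprD addrNK.
Qed.

Lemma expgzN x k : expgz x (- k) = (expgz x k)^-1.
Proof. by symmetry; apply: mulg1_eq; rewrite -expgzD subrr. Qed.

Lemma cyclic_subgroupE x : cyclic_subgroup x = range (expgz x).
Proof.
apply/seteqP; split=> y; first by case=> n [] ->;
  [exists (Posz n) | exists (- Posz n)%R; rewrite ?expgzN].
by case=> -[] n _ <-; [exists n; left | exists n.+1; right].
Qed.

Lemma subgroup_expgz (K : set G) x k : subgroup K -> K x -> K (expgz x k).
Proof.
move=> [K1 KM KV] Kx.
elim: k => [//|n IH|n IH]; first by rewrite -addn1 PoszD expgz_succ; apply: KM.
by rewrite -addn1 PoszD opprD expgzD; apply: KM => //; apply: KV.
Qed.

Lemma additive_expgz (K : set G) (f : G -> int) x k :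
    subgroup K -> additive_on K f ->
  K x -> f (expgz x k) = (k * f x)%R.
Proof.
move=> Kg fM Kx; have [K1 _ _] := Kg.
have f1 : f 1 = 0%R.
  by apply: (@addrI _ (f 1)); rewrite -fM ?mulg1 ?addr0.
have Kz l : K (expgz x l) by apply: subgroup_expgz.
have fS l : f (expgz x (l + 1)) = (f (expgz x l) + f x)%R.
  by rewrite expgz_succ fM.
elim: k => [|n IH|n IH]; first by rewrite mul0r.
  by rewrite -addn1 PoszD fS IH mulrDl mul1r.
apply: (@addIr _ (f x)); rewrite -fS -addn1 PoszD opprD addrNK IH.
by rewrite mulrDl mulN1r addrNK.
Qed.

(** Euclidean division: an element with the least positive value of [f] generates [K]; if no value
    is positive, [K] is trivial. *)
Lemma int_embedding_cyclic (K : set G) (f : G -> int) :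
    subgroup K -> additive_on K f ->
    (forall x, K x -> f x = 0%R -> x = 1) ->
  cyclic K.
Proof.
move=> Kg fM ker_f; have [K1 KM KV] := Kg.
suff [g Kg0 gP] : exists2 g, K g & forall x, K x -> (f g %| f x)%Z.
  exists g; rewrite cyclic_subgroupE; apply/seteqP; split=> [x Kx | _ [k _ <-]];
    last exact: subgroup_expgz.
  have /dvdzP [k fx] := gP x Kx; exists k => //.
  have Ky : K (expgz g (- k)) by apply: subgroup_expgz.
  apply: divg1_eq; apply: (@invg_inj G); rewrite invg1 invgF -expgzN.
  apply: ker_f; first exact: KM.
  by rewrite fM // (additive_expgz _ Kg fM Kg0) fx mulNr subrr.
(* The shift to [n.+1] builds positivity into [P]. *)
pose P n := `[< exists2 x, K x & f x = Posz n.+1 >].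
have [[n Pn] | no_pos] := pselect (exists n, P n).
  have [d /asboolP [g Kg0 fg] d_min] := ex_minnP (ex_intro P n Pn).
  exists g => // x Kx; apply/dvdzP; exists (f x %/ f g)%Z.
  rewrite {1}(divz_eq (f x) (f g)); set q := (f x %/ f g)%Z.
  have Kq : K (expgz g (- q)) by apply: subgroup_expgz.
  have fr : f (x * expgz g (- q)) = (f x %% f g)%Z.
    by rewrite fM // (additive_expgz _ Kg fM Kg0) mulNr.
  have Kr : K (x * expgz g (- q)) by apply: KM.
  have fg_gt0 : (0 < f g)%R by rewrite fg.
  have := ltz_pmod (f x) fg_gt0; have := modz_ge0 (f x) (lt0r_neq0 fg_gt0).
  (* A nonzero remainder would be a positive value of [f] on [K] below [f g]. *)
  case: (f x %% f g)%Z fr => // [[|r]] fr _; first by rewrite addr0.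
  rewrite fg ltz_nat ltnS ltnNge d_min //.
  by apply/asboolP; exists (x * expgz g (- q)).
exists 1 => // x Kx; suff -> : x = 1 by [].
have f1 : f 1 = 0%R by have := additive_expgz 0 Kg fM K1; rewrite mul0r.
(* A negative value at [x] would be a positive one at its inverse. *)
apply: ker_f => //; case fx: (f x) => [[|n] | n] //.
  by case: no_pos; exists n; apply/asboolP; exists x.
case: no_pos; exists n; apply/asboolP; exists (expgz x (- 1)).
  exact: subgroup_expgz.
by rewrite (additive_expgz _ Kg fM Kx) fx NegzE mulN1r opprK.
Qed.

End IntegerPowers.

(** Pigeonhole: one more power of [x] than the length of a list of [H] forces a repetition. *)
Lemma subgroup_of_finite_order (G : groupType) (H : set G) :
    subgroup H -> finite_set H ->
  forall x, H x -> exists2 n, (0 < n)%N & x ^+ n = 1.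
Proof.
move=> [H1 HM _] /finite_seqP [s Hs] x Hx.
have Hxn n : x ^+ n \in s.
  suff: H (x ^+ n) by rewrite Hs.
  by elim: n => [|n IH] //; rewrite expgS; apply: HM.
pose t := [seq x ^+ i | i <- iota 0 (size s).+1].
have : ~~ uniq t.
  apply/negP => /uniq_leq_size t_le; suff /t_le : {subset t <= s}.
    by rewrite size_map size_iota ltnn.
  by move=> _ /mapP [i _ ->].
case/(uniqPn 1) => i [j [lt_ij]]; rewrite size_map size_iota => lt_j.
rewrite !(nth_map 0%N) ?size_iota //; last exact: ltn_trans lt_j.
rewrite !nth_iota //; last exact: ltn_trans lt_j.
rewrite !add0n -[in x ^+ j](subnK (ltnW lt_ij)) expgnDr => xij.
exists (j - i)%N; rewrite ?subn_gt0 //.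
by apply: (@mulIg _ (x ^+ i)); rewrite mul1g.
Qed.

(** * The transfer to the central subgroup generated by [z] *)

Section Transfer.
Variables (G : groupType) (z : G).
Hypothesis cz : central z.
Let Q := quotient_group (central_cycle cz).
Let pi : G -> Q := @coset G (central_cycle cz).
Variable s : seq Q.
Hypotheses (s_uniq : uniq s) (s_group : subgroup [set` s]).

Let K : set G := [set x | pi x \in s].

Lemma preimage_power x : K x -> exists2 n, (0 < n)%N & range (expgz z) (x ^+ n).
Proof.
move=> Kx.
have [n n_gt0 xn] := subgroup_of_finite_order s_group (finite_seq s) Kx.
have piXn k : pi (x ^+ k) = pi x ^+ k.
  by elim: k => [//|k IH]; rewrite !expgS -IH -cosetM.
exists n => //; rewrite -cyclic_subgroupE -[x ^+ n]mul1g -{1}invg1.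
apply/(eq_coset (central_cycle cz)).
exact/esym/(etrans (piXn n)).
Qed.

Hypotheses (G_torsion_free : torsion_free G) (z_neq1 : z <> 1).

Lemma expgz_inj : injective (expgz z).
Proof.
suff inj0 k : expgz z k = 1 -> k = 0%R.
  move=> k l kl; apply: subr0_eq; apply: inj0.
  by rewrite expgzD expgzN kl mulgV.
case: k => [[|n] | n] //= zn; case: z_neq1;
  apply: (G_torsion_free (n := n.+1)) => //.
by apply: invg_inj; rewrite zn invg1.
Qed.

(** The factor at [h] of the classical transfer, for the transversal [coset_repr]. *)
Definition transfer_cocycle (x : G) (h : Q) : G :=
  (coset_repr (pi x * h))^-1 * x * coset_repr h.

Lemma transfer_cocycleP x h : range (expgz z) (transfer_cocycle x h).
Proof.
rewrite -cyclic_subgroupE /transfer_cocycle -mulgA.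
apply/(eq_coset (central_cycle cz)).
by rewrite cosetM !coset_reprK.
Qed.

Lemma transfer_cocycleM x y h :
  transfer_cocycle (x * y) h =
    transfer_cocycle x (pi y * h) * transfer_cocycle y h.
Proof. by rewrite /transfer_cocycle /pi cosetM !mulgA mulgK. Qed.

(** The default 0 is never met in [transfer], since every cocycle value is a power of [z]. *)
Definition central_log (w : G) : int := xget 0%R [set k | expgz z k = w].

Lemma expgzK : cancel (expgz z) central_log.
Proof.
move=> k; apply: expgz_inj.
exact: (xgetPex _ (ex_intro (fun l => expgz z l = expgz z k) k erefl)).
Qed.

Definition transfer (x : G) : int :=
  (\sum_(h <- s) central_log (transfer_cocycle x h))%R.

Lemma preimage_subgroup : subgroup K.
Proof.
have [H1 HM HV] := s_group; split=> //= x.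
  by move=> y Kx Ky; rewrite /K /= /pi cosetM; apply: HM.
by move=> Kx; rewrite /K /= /pi -coset_inv; apply: HV.
Qed.

Lemma transferM : additive_on K transfer.
Proof.
have [_ HM HV] := s_group.
move=> x y _ Ky; rewrite /transfer.
(* Translation by [pi y] permutes [s], which reindexes the sum for [x] to match the cocycle
   identity. *)
have perm_s : perm_eq [seq pi y * h | h <- s] s.
  apply: uniq_perm => //; first by rewrite map_inj_uniq //; apply: mulgI.
  move=> h; apply/mapP/idP => [[k ks ->] | hs]; first exact: HM.
  by exists ((pi y)^-1 * h); [apply: HM => //; apply: HV | rewrite mulVKg].
rewrite -[in RHS](perm_big _ perm_s) big_map -big_split /=.
apply: eq_bigr => h _; rewrite transfer_cocycleM.
have [k _ <-] := transfer_cocycleP x (pi y * h).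
have [l _ <-] := transfer_cocycleP y h.
by rewrite -expgzD !expgzK.
Qed.

Lemma pi_z : pi z = 1.
Proof.
apply/(eq_coset (central_cycle cz)); exists 1%N; right.
by rewrite mulg1.
Qed.

(** As [z] is central and trivial in the quotient, each cocycle value is [z] and contributes 1. *)
Lemma transfer_z : transfer z = size s.
Proof.
rewrite /transfer (eq_bigr (fun=> 1%R)) => [|h _].
  by rewrite big_const_seq count_predT iter_addr_0 natz.
rewrite /transfer_cocycle pi_z mul1g -mulgA cz mulKg.
by rewrite -[RHS]expgzK.
Qed.

(** Some positive power of [x] is [z] to some [k]; applying [transfer] gives [k * size s = 0], so
    [k = 0] and [x] is torsion. *)
Lemma transfer_ker x : K x -> transfer x = 0%R -> x = 1.
Proof.
have Kg := preimage_subgroup; have [H1 _ _] := s_group.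
move=> Kx fx; have [n n_gt0 [k _ zk]] := preimage_power Kx.
apply: (G_torsion_free n_gt0).
have := additive_expgz n Kg transferM Kx; rewrite fx mulr0 /= -zk.
rewrite (additive_expgz k Kg transferM); last by rewrite /K /= pi_z.
rewrite transfer_z => /eqP; rewrite mulf_eq0 => /orP [/eqP -> // | ].
(* The list [s] contains 1, so its size is nonzero. *)
by move: H1 => /=; case: (s).
Qed.

Lemma extension_cyclic : cyclic [set` s].
Proof.
have [g Kg] := int_embedding_cyclic preimage_subgroup transferM transfer_ker.
have piz k : pi (expgz g k) = expgz (pi g) k.
  elim: k => [|n IH|n IH].
  - by [].
  - by rewrite -addn1 PoszD !expgz_succ -IH -cosetM.
  - apply: (@mulIg _ (pi g)); rewrite -expgz_succ -cosetM -expgz_succ.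
    by rewrite -addn1 PoszD opprD addrNK.
have KE x : K x <-> range (expgz g) x by rewrite Kg cyclic_subgroupE.
exists (pi g); rewrite cyclic_subgroupE; apply/seteqP.
split=> [h /= hs | _ [k _ <-]].
  have /KE [k _ kh] : K (coset_repr h) by rewrite /K /= /pi coset_reprK.
  by exists k => //; rewrite -piz kh /pi coset_reprK.
by rewrite -piz; apply/KE; exists k.
Qed.

End Transfer.

Theorem theorem3p17 (G : groupType) (Delta : G) (m : nat)
    (HG : garside_group Delta) (Hm : least_central_power Delta m)
    (H : set (quotient_group
                (central_cycle (least_central_power_central Hm)))) :
  subgroup H -> finite_set H -> cyclic H.
Proof.
move=> Hg /finite_seqP [s Hs].
(* The transfer must count each element of [H] once. *)
have {}Hs : H = [set` undup s].
  by rewrite Hs; apply/seteqP; split=> x /=; rewrite mem_undup.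
have G_tf := garside_torsion_free HG.
rewrite Hs in Hg *.
(* The trivial group is Garside with [Delta = 1], so this power may be 1; representatives of
   elements of [H] are then torsion, and [H] is trivial. *)
have [z1 | z_neq1] := pselect (Delta ^+ m = 1); last first.
  exact: extension_cyclic (undup_uniq s) Hg G_tf z_neq1.
exists 1; rewrite cyclic_subgroupE; have [H1 _ _] := Hg.
have zX k : expgz (Delta ^+ m) k = 1.
  by rewrite z1; case: k => n /=; rewrite expg1n ?invg1.
apply/seteqP; split=> [h hs | _ [k _ <-]]; last exact: subgroup_expgz.
exists 0%R => //.
have : coset _ (coset_repr h) \in undup s by rewrite coset_reprK.
case/(preimage_power Hg) => n n_gt0 [k _]; rewrite zX => /esym.
by move=> /(G_tf _ _ n_gt0) h1; rewrite -[h]coset_reprK h1.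
Qed.
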